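(* For a monoid $S$ the following statements are equivalent. (i) All right $S$-acts are InD-injective. (ii) All indecomposable right $S$-acts are InD-injective. (iii) All right $S$-acts are PInD-injective. (iv) All indecomposable right $S$-acts are PInD-injective. (v) All indecomposable right $S$-acts are injective. (vi) $S$ is right absolutely injective. (vii) $S$ contains a left zero and every right ideal of $S$ is generated by a special idempotent.
   Context: $S$ is a monoid with identity $1$. A right $S$-act is a non-empty set $A$ with a unitary right action of $S$, i.e. $(as)t=a(st)$ and $a1=a$. Subacts and right ideals are non-empty; homomorphisms are maps commuting with the action. An act is decomposable if it is the union of two disjoint (non-empty) subacts, and indecomposable otherwise. An act $A$ is injective if for every act $B$, every subact $C\subseteq B$ and every homomorphism $f:C\to A$ there is a homomorphism $\overline f:B\to A$ with $\overline f|_C=f$. It is InD-injective (indecomposable domain injective) if this extension property holds whenever the subact $C$ is indecomposable ($B$ arbitrary). It is PInD-injective (pseudo indecomposable domain injective) if this extension property holds whenever $C$ is indecomposable and $f$ is a monomorphism (i.e. injective as a map). $S$ is right absolutely injective if all right $S$-acts are injective. A left zero of $S$ is an element $z\in S$ with $zs=z$ for all $s\in S$. An idempotent $e\in S$ is special if for every right congruence $\rho$ on $S$ there exists $k\in eS$ such that $(ke)\,\rho\, e$ and, for all $u,v\in S$, $u\,\rho\, v$ implies $(ku)\,\rho\,(kv)$. *)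

(* Defs.v *)
From HB Require Import structures.
From mathcomp Require Import all_boot.
From mathcomp Require Import boolp classical_sets.

Set Implicit Arguments.
Unset Strict Implicit.
Unset Printing Implicit Defensive.

Local Open Scope classical_set_scope.
Local Open Scope group_scope.

(* Right S-acts; the carrier is an arbitrary non-empty type. *)
Record act (S : monoidType) := Act {
  act_sort :> Type;
  actr : act_sort -> S -> act_sort;
  act_inhabited : inhabited act_sort;
  actrM : forall a s t, actr (actr a s) t = actr a (s * t);
  actr1 : forall a, actr a 1 = a
}.

Definition act_hom (S : monoidType) (A B : act S) (f : A -> B) : Prop :=
  forall a s, f (actr a s) = actr (f a) s.

Record subact (S : monoidType) (B : act S) := Subact {
  subact_set :> set B;
  subact_nonempty : subact_set !=set0;
  subact_closed : forall b s, subact_set b -> subact_set (actr b s)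
}.

Section ActOfSubact.
Variables (S : monoidType) (B : act S) (C : subact B).

Definition subact_sort : Type := {b : B | subact_set C b}.

Definition subact_actr (c : subact_sort) (s : S) : subact_sort :=
  exist _ (actr (sval c) s) (subact_closed s (svalP c)).

Fact subact_inhabited : inhabited subact_sort.
Proof. by have [b Cb] := subact_nonempty C; constructor; exists b. Qed.

Fact subact_actrM c s t :
  subact_actr (subact_actr c s) t = subact_actr c (s * t).
Proof. by apply: eq_exist; rewrite /= actrM. Qed.

Fact subact_actr1 c : subact_actr c 1 = c.
Proof. by case: c => b Cb; apply: eq_exist; rewrite /= actr1. Qed.

Definition act_of_subact : act S :=
  Act subact_inhabited subact_actrM subact_actr1.

End ActOfSubact.

Section RegularAct.
Variable S : monoidType.

Fact regular_actrM (a s t : S) : a * s * t = a * (s * t).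
Proof. by rewrite mulgA. Qed.

Definition regular_act : act S :=
  @Act S S (fun a s => a * s) (inhabits 1) regular_actrM (@mulg1 S).

End RegularAct.

Definition decomposable (S : monoidType) (A : act S) : Prop :=
  exists C D : subact A, C `&` D = set0 /\ C `|` D = setT.

Definition indecomposable (S : monoidType) (A : act S) : Prop :=
  ~ decomposable A.

Definition extends_to (S : monoidType) (A B : act S) (C : subact B)
    (f : act_of_subact C -> A) : Prop :=
  exists g : B -> A,
    act_hom g /\ forall c : act_of_subact C, g (sval c) = f c.

Definition injective_act (S : monoidType) (A : act S) : Prop :=
  forall (B : act S) (C : subact B) (f : act_of_subact C -> A),
    act_hom f -> extends_to f.

Definition InD_injective (S : monoidType) (A : act S) : Prop :=
  forall (B : act S) (C : subact B) (f : act_of_subact C -> A),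
    indecomposable (act_of_subact C) -> act_hom f -> extends_to f.

Definition PInD_injective (S : monoidType) (A : act S) : Prop :=
  forall (B : act S) (C : subact B) (f : act_of_subact C -> A),
    indecomposable (act_of_subact C) -> act_hom f -> injective f ->
    extends_to f.

Definition right_absolutely_injective (S : monoidType) : Prop :=
  forall A : act S, injective_act A.

Definition right_ideal (S : monoidType) : Type := subact (regular_act S).

Definition principal_right_ideal (S : monoidType) (e : S) : set S :=
  [set e * s | s in setT].

Record right_congruence (S : monoidType) (rho : S -> S -> Prop) : Prop := {
  right_congruence_refl : forall u, rho u u;
  right_congruence_sym : forall u v, rho u v -> rho v u;
  right_congruence_trans : forall u v w, rho u v -> rho v w -> rho u w;
  right_congruence_mulr : forall u v s, rho u v -> rho (u * s) (v * s)
}.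

Definition special_idempotent (S : monoidType) (e : S) : Prop :=
  e * e = e /\
  forall rho : S -> S -> Prop, right_congruence rho ->
    exists k : S, [/\ principal_right_ideal e k,
                      rho (k * e) e
                    & forall u v, rho u v -> rho (k * u) (k * v)].

(* Main.v *)
Require Import Defs.
From mathcomp Require Import all_boot generic_quotient.
From mathcomp Require Import boolp classical_sets.

(** Two ideas drive the equivalence.

    First, the pushout of a homomorphism [f : C -> A] along [C <= B] turns an
    extension problem for [f] into the problem of retracting the pushout onto
    [A].  So [A] is injective as soon as the identity of [A] extends to every
    act that contains [A].  When [A] is indecomposable, this identity is a
    monomorphism with indecomposable domain, hence PInD-injectivity already
    gives injectivity ([PInD_injective_retract] and
    [absolute_retract_injective]).  InD-injectivity of the indecomposable acts
    gives PInD-injectivity of all acts because a homomorphism with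
    indecomposable domain corestricts to its image, which is indecomposable.

    If all indecomposable acts are injective, retracting [S] with a fixed point
    adjoined onto [S] provides a left zero.  It is unique: given two of them,
    an amalgam of two copies of [S] is an indecomposable act that contains two
    zeros with no copy of [S] through both of them, so the pair of left zeros
    has a map to this act that does not extend to [S] ([left_zero_unique]).
    A unique left zero [z] is two-sided, so [b |-> b z] is invariant under the
    action and cuts every act into indecomposable fibres; extending a
    homomorphism fibre by fibre shows that all acts are injective
    ([absolutely_injective_of_indecomposable]).

    Second, injectivity of all acts and special idempotents match each other.
    A retraction of [S] onto a right ideal [I] is left multiplication by an
    idempotent [e] with [I = eS], and a retraction of [S / rho] onto the image
    of [I] is left multiplication by an element [k] as in the definition of a
    special idempotent ([special_idempotent_generator]).  Conversely, by Zorn's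
    lemma it suffices to extend a partial homomorphism [h] to one more element
    [b].  The elements [s] with [b s] in the domain of [h] form a right ideal
    [eS]; if [k] is associated with [e] and the congruence
    [b u = b v], then [b s |-> h (b k) s] is well defined and agrees with [h],
    since [b k e = b e] ([partial_hom_extend_point]).  If no [b s] lies in the
    domain, [b] can be sent to a zero, which exists thanks to the left zero
    of [S]. *)

Set Implicit Arguments.
Unset Strict Implicit.
Unset Printing Implicit Defensive.

Local Open Scope classical_set_scope.
Local Open Scope group_scope.
Local Open Scope quotient_scope.

Lemma sval_inj (T : Type) (P : T -> Prop) : injective (@sval T P).
Proof. by move=> [x Px] [y Py] /= xy; apply: eq_exist. Qed.

(** * Indecomposable acts *)

(** A decomposition amounts to a non-constant predicate that the action
    preserves in both directions; in this form, indecomposability is proved by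
    linking elements through their multiples. *)
Lemma indecomposableP (S : monoidType) (A : act S) :
  indecomposable A <->
  forall P : set A, (forall a s, P (actr a s) <-> P a) ->
    forall a b, P a -> P b.
Proof.
split=> [indecA P Pact a b Pa | connA [C [D [CD0 CDT]]]].
  have [//|nPb] := pselect (P b); exfalso; apply: indecA.
  have Pcl c s : P c -> P (actr c s) by move/Pact.
  have nPcl c s : (~` P) c -> (~` P) (actr c s) by move=> nPc /Pact.
  exists (Subact (ex_intro _ a Pa) Pcl), (Subact (ex_intro _ b nPb) nPcl).
  by split; [exact: setICr | exact: setUv].
have CorD a : subact_set C a \/ subact_set D a.
  by rewrite -[_ \/ _]/((C `|` D) a) CDT.
have nCD a : subact_set C a -> ~ subact_set D a.
  by move=> Ca Da; rewrite -[False]/(set0 a) -CD0.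
have Cact a s : subact_set C (actr a s) <-> subact_set C a.
  split=> [Cas|]; last exact: subact_closed.
  by have [//|/(subact_closed s)/nCD] := CorD a.
have [c Cc] := subact_nonempty C; have [d Dd] := subact_nonempty D.
exact: nCD (connA C Cact c d Cc) Dd.
Qed.

Lemma indecomposable_image (S : monoidType) (A B : act S) (f : A -> B) :
  act_hom f -> (forall b, exists a, f a = b) ->
  indecomposable A -> indecomposable B.
Proof.
move=> fhom fsurj /indecomposableP indecA; apply/indecomposableP => P Pact.
move=> b b'; have [a <-] := fsurj b; have [a' <-] := fsurj b'.
by apply: (indecA (fun x => P (f x))) => x s; rewrite fhom.
Qed.

Lemma indecomposable_regular (S : monoidType) :
  indecomposable (regular_act S).
Proof.
apply/indecomposableP => P Pact a b.
have P1 s : P s <-> P 1 by rewrite -(Pact 1 s) /= mul1g.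
by rewrite (P1 a) (P1 b).
Qed.

Definition image_subact (S : monoidType) (A B : act S) (f : A -> B)
    (fhom : act_hom f) : subact B.
Proof.
apply: (@Subact S B (range f)).
  by have [a] := act_inhabited A; exists (f a), a.
by move=> _ s [a _ <-]; exists (actr a s); rewrite // fhom.
Defined.

Lemma indecomposable_image_subact (S : monoidType) (A B : act S) (f : A -> B)
    (fhom : act_hom f) :
  indecomposable A -> indecomposable (act_of_subact (image_subact fhom)).
Proof.
have fP a : range f (f a) by exists a.
apply: (@indecomposable_image _ _ (act_of_subact (image_subact fhom))
          (fun a => exist _ (f a) (fP a))) => [a s | x].
  by apply: sval_inj; rewrite /= fhom.
by have [a _ fa] := svalP x; exists a; apply: sval_inj.
Qed.

(** * Gluing acts *)

Section Glue.
Variables (S : monoidType) (A B : act S) (D : set B) (f : B -> A).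
Hypothesis Dclosed : forall b s, D b -> D (actr b s).
Hypothesis fhom : forall b s, D b -> f (actr b s) = actr (f b) s.

(** The pushout of [B] and [A] along [f : D -> A], with [A] kept whole and each
    [b] in [D] replaced by [f b].  [D] is a set rather than a subact because
    [D] empty, which gives the disjoint union, is needed to adjoin zeros. *)
Definition glue_sort : Type := (A + {b : B | ~ D b})%type.

Definition glue_in (b : B) : glue_sort :=
  match pselect (D b) with
  | left _ => inl (f b)
  | right nDb => inr (exist _ b nDb)
  end.

Lemma glue_in_mem b : D b -> glue_in b = inl (f b).
Proof. by rewrite /glue_in; case: pselect. Qed.

Lemma glue_in_nmem (x : {b : B | ~ D b}) : glue_in (sval x) = inr x.
Proof.
rewrite /glue_in; case: pselect => [/(svalP x)//|nDb].
by congr inr; apply: sval_inj.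
Qed.

Definition glue_actr (x : glue_sort) (s : S) : glue_sort :=
  match x with
  | inl a => inl (actr a s)
  | inr b => glue_in (actr (sval b) s)
  end.

Lemma glue_in_hom b s : glue_in (actr b s) = glue_actr (glue_in b) s.
Proof.
rewrite {2}/glue_in; case: pselect => //= Db.
by rewrite glue_in_mem ?fhom //; exact: Dclosed.
Qed.

Fact glue_inhabited : inhabited glue_sort.
Proof. by have [a] := act_inhabited A; constructor; left. Qed.

Fact glue_actrM x s t : glue_actr (glue_actr x s) t = glue_actr x (s * t).
Proof. by case: x => [a|b] /=; rewrite -?glue_in_hom actrM. Qed.

Fact glue_actr1 x : glue_actr x 1 = x.
Proof. by case: x => [a|b] /=; rewrite actr1 ?glue_in_nmem. Qed.

Definition glue_act : act S := Act glue_inhabited glue_actrM glue_actr1.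

End Glue.

(** * Retracts and injectivity *)

Definition absolute_retract (S : monoidType) (A : act S) : Prop :=
  forall (P : act S) (i : A -> P), act_hom i -> injective i ->
    exists r : P -> A, act_hom r /\ cancel i r.

Lemma injective_PInD_injective (S : monoidType) (A : act S) :
  injective_act A -> PInD_injective A.
Proof. by move=> injA B C f _ fhom _; exact: injA. Qed.

(** The copy [i A] of [A] inside [P] is indecomposable, and the inverse of [i]
    on it is a monomorphism, so it extends to [P]. *)
Lemma PInD_injective_retract (S : monoidType) (A : act S) :
  indecomposable A -> PInD_injective A -> absolute_retract A.
Proof.
move=> indecA injA P i ihom iinj.
pose C := act_of_subact (image_subact ihom).
have inv (c : C) : exists a, i a = sval c by have [a _ ia] := svalP c; exists a.
have [j ij] := choice inv.
have jhom : act_hom j by move=> c s; apply: iinj; rewrite ihom !ij.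
have jinj : injective j.
  by move=> c d jcd; apply: sval_inj; rewrite -!ij jcd.
have indecC := indecomposable_image_subact (fhom := ihom) indecA.
have [r [rhom rj]] := injA P (image_subact ihom) j indecC jhom jinj.
exists r; split=> // a; have ia : range i (i a) by exists a.
by rewrite (rj (exist _ (i a) ia)); apply: iinj; rewrite ij.
Qed.

(** Describing the map on a subact as the restriction of a function on [B]
    avoids handling elements of the subtype. *)
Lemma injective_act_total (S : monoidType) (A B : act S) (C : subact B)
    (f : B -> A) :
  injective_act A ->
  (forall c s, subact_set C c -> f (actr c s) = actr (f c) s) ->
  exists g : B -> A, act_hom g /\ forall c, subact_set C c -> g c = f c.
Proof.
move=> injA fhom; pose f' (c : act_of_subact C) := f (sval c).
have [|g [ghom gf]] := injA B C f'; first by move=> [c Cc] s; exact: fhom.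
by exists g; split=> // c Cc; rewrite (gf (exist _ c Cc)).
Qed.

(** Retracting onto [A] the pushout of [A] and [B] along [f], and composing with
    the map from [B] to this pushout, extends [f]. *)
Lemma absolute_retract_injective (S : monoidType) (A : act S) :
  absolute_retract A -> injective_act A.
Proof.
move=> retA B C f fhom; have [a0] := act_inhabited A.
pose F b :=
  if pselect (subact_set C b) is left Cb then f (exist _ b Cb) else a0.
have Ff (c : act_of_subact C) : F (sval c) = f c.
  rewrite /F; case: pselect => [Cc|]; last by case: c.
  by congr f; apply: sval_inj.
have Fhom b s : subact_set C b -> F (actr b s) = actr (F b) s.
  move=> Cb; rewrite -[b in RHS]/(sval (exist _ b Cb : act_of_subact C)) Ff.
  by rewrite -fhom -Ff.
pose P := glue_act (@subact_closed _ _ C) Fhom.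
have inl_inj : injective (inl : A -> P) by move=> x y [].
have [r [rhom rK]] := retA P inl (fun _ _ => erefl) inl_inj.
exists (fun b => r (glue_in C F b)); split=> [b s | c].
  by rewrite -rhom (glue_in_hom (@subact_closed _ _ C) Fhom).
by rewrite glue_in_mem ?rK ?Ff //; exact: svalP.
Qed.

(** * Zeros *)

Definition point_act (S : monoidType) : act S :=
  @Act S unit (fun _ _ => tt) (inhabits tt) (fun _ _ _ => erefl)
    (fun a => let: tt := a in erefl).

(** The zero is the image of the extra point under a retraction onto [A] of the
    disjoint union of [A] with a one-point act. *)
Lemma absolute_retract_zero (S : monoidType) (A : act S) :
  absolute_retract A -> exists a : A, forall s, actr a s = a.
Proof.
move=> retA; have [a0] := act_inhabited A.
have Dcl (b : point_act S) (s : S) : set0 b -> set0 (actr b s) by [].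
have fhom (b : point_act S) (s : S) : set0 b -> a0 = actr a0 s by [].
pose P := @glue_act S A (point_act S) set0 (fun=> a0) Dcl fhom.
have inl_inj : injective (inl : A -> P) by move=> x y [].
have [r [rhom _]] := retA P inl (fun _ _ => erefl) inl_inj.
exists (r (glue_in set0 (fun=> a0) (tt : point_act S))) => s.
rewrite -rhom; congr r.
exact: (esym (glue_in_hom Dcl fhom (tt : point_act S) s)).
Qed.

Lemma exists_left_zero (S : monoidType) :
  PInD_injective (regular_act S) -> exists z : S, left_zero z *%g.
Proof.
move=> /(PInD_injective_retract (@indecomposable_regular S)).
exact: absolute_retract_zero.
Qed.

(** Were [z1] and [z2] distinct, glue two copies of [S] along [z1].  The amalgam
    [P] is indecomposable, as the copies are cyclic and meet, hence it is
    injective and the homomorphism from [{z1, z2}] that sends [z1] to the first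
    copy of [z2] and [z2] to the second one extends to [S].  The image of [1]
    under the extension lies in one of the copies, and so do all its multiples;
    but the two copies of [z2] lie in no common copy of [S]. *)
Lemma left_zero_unique (S : monoidType) (z1 z2 : S) :
  (forall A : act S, indecomposable A -> injective_act A) ->
  left_zero z1 *%g -> left_zero z2 *%g -> z1 = z2.
Proof.
move=> injS z1P z2P; have [//|z12] := pselect (z1 = z2); exfalso.
pose D := [set z1] : set (regular_act S).
have Dcl (b : regular_act S) (s : S) : D b -> D (actr b s).
  by move=> ->; exact: z1P.
pose P := @glue_act S (regular_act S) _ D id Dcl (fun _ _ _ => erefl).
pose i2 : regular_act S -> P := glue_in D id.
have i2hom : act_hom i2.
  by move=> b s; exact: (glue_in_hom Dcl (fun _ _ _ => erefl)).
have i2z1 : i2 z1 = inl z1 by exact: glue_in_mem.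
have nDz2 : ~ D z2 by move=> z21; apply: z12.
have i2z2 : i2 z2 = inr (exist _ z2 nDz2).
  exact: (@glue_in_nmem S (regular_act S) _ D id (exist _ z2 nDz2)).
have indecP : indecomposable P.
  apply/indecomposableP => Q Qact.
  have Q1 s : Q (inl s) <-> Q (inl z1).
    have Qinl t : Q (inl t) <-> Q (inl 1).
      by rewrite -(Qact (inl 1) t) /= mul1g.
    by rewrite !Qinl.
  have Q2 s : Q (i2 s) <-> Q (inl z1).
    have Qi2 t : Q (i2 t) <-> Q (i2 1).
      by rewrite -(Qact (i2 1) t) -i2hom /= mul1g.
    by rewrite -i2z1 (Qi2 s) (Qi2 z1).
  have Qall x : Q x <-> Q (inl z1).
    by case: x => [//|x]; rewrite -(@glue_in_nmem S (regular_act S) _ D id x).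
  by move=> x y; rewrite (Qall x) (Qall y).
have Ccl (b : regular_act S) (s : S) :
    [set z1; z2] b -> [set z1; z2] (actr b s).
  by case=> ->; [left; exact: z1P | right; exact: z2P].
have C0 : [set z1; z2] !=set0 by exists z1; left.
pose C := @Subact S (regular_act S) _ C0 Ccl.
pose f (b : regular_act S) : P := if b == z1 :> S then inl z2 else i2 z2.
have fhom c s : subact_set C c -> f (actr c s) = actr (f c) s.
  have fz2 : f z2 = i2 z2 by rewrite /f; case: eqP => // z21; case: z12.
  case=> ->; last by rewrite [actr _ s]z2P fz2 -i2hom [actr _ s]z2P.
  by rewrite [actr _ s]z1P /f eqxx /= z2P.
have [g [ghom gf]] := injective_act_total (injS P indecP) fhom.
have gz1 : actr (g 1) z1 = inl z2.
  by rewrite -ghom /= mul1g gf /f ?eqxx //; left.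
have gz2 : actr (g 1) z2 = i2 z2.
  rewrite -ghom /= mul1g gf /f; last by right.
  by case: eqP => // z21; case: z12.
case: (g 1) gz1 gz2 => [a _|x]; first by rewrite i2z2.
rewrite /= -/(i2 _) => + _; rewrite /i2 /glue_in; case: pselect => //.
by rewrite /D /= => -> [].
Qed.

(** With [z] the two-sided zero of [S], the map [x |-> x z] is constant on orbits
    and its fibres are indecomposable, because each contains the zero to which
    [z] sends all its elements.  A homomorphism [f] maps the fibre over [t] into
    the fibre over [f t], so it can be extended on each fibre separately. *)
Lemma absolutely_injective_of_indecomposable (S : monoidType) :
  (forall A : act S, indecomposable A -> injective_act A) ->
  right_absolutely_injective S.
Proof.
move=> injS A B C f fhom.
have [z zl] := exists_left_zero
  (injective_PInD_injective (injS _ (@indecomposable_regular S))).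
have zr s : s * z = z.
  apply: (left_zero_unique injS _ zl) => t.
  by rewrite -mulgA zl.
have actz (X : act S) (x : X) s : actr (actr x s) z = actr x z.
  by rewrite actrM zr.
have zact (X : act S) (x : X) s : actr (actr x z) s = actr x z.
  by rewrite actrM zl.
have part (t : B) : exists g : B -> A,
    (forall b s, actr b z = t -> g (actr b s) = actr (g b) s) /\
    (forall c : act_of_subact C, actr (sval c) z = t -> g (sval c) = f c).
  have [a0] := act_inhabited A.
  have [[c0 c0t]|nC] :=
      pselect (exists c : act_of_subact C, actr (sval c) z = t); last first.
    (* No element of [C] lies over [t], hence any zero of [A] will do. *)
    exists (fun=> actr a0 z); split=> [b s _|c ct]; first by rewrite zact.
    by case: nC; exists c.
  (* The subact [D] of [C] over [t] goes into the fibre [F] of [A] over [u],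
     which is injective. *)
  pose u := actr (f c0) z.
  have Fcl (a : A) s : [set a | actr a z = u] a ->
      [set a | actr a z = u] (actr a s) by move=> /= <-; exact: actz.
  have F0 : [set a : A | actr a z = u] !=set0 by exists u; exact: zact.
  pose F := act_of_subact (Subact F0 Fcl).
  have indecF : indecomposable F.
    apply/indecomposableP => P Pact a b.
    rewrite -(Pact a z) -(Pact b z).
    suff -> : actr a z = actr b z by [].
    apply: sval_inj; exact: etrans (svalP a) (esym (svalP b)).
  have Dcl (b : B) s : [set b | subact_set C b /\ actr b z = t] b ->
      [set b | subact_set C b /\ actr b z = t] (actr b s).
    by move=> [Cb bt]; split; [exact: subact_closed | rewrite actz].
  have D0 : [set b | subact_set C b /\ actr b z = t] !=set0.
    by exists (sval c0); split; [exact: svalP|].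
  pose D := Subact D0 Dcl.
  pose toC (d : act_of_subact D) : act_of_subact C :=
    exist _ (sval d) (proj1 (svalP d)).
  have toF (d : act_of_subact D) : actr (f (toC d)) z = u.
    rewrite /u -!fhom; congr f; apply: sval_inj => /=.
    by rewrite c0t; case: (svalP d).
  have [|g [ghom gf]] :=
      injS F indecF B D (fun d => exist _ (f (toC d)) (toF d)).
    move=> d s; apply: sval_inj; rewrite /= -fhom; congr f.
    exact: sval_inj.
  exists (fun b => sval (g b)); split=> [b s _|c ct]; first by rewrite ghom.
  have Dc : subact_set D (sval c) by split; [exact: svalP|].
  rewrite (gf (exist _ (sval c) Dc)) /=; congr f; exact: sval_inj.
have [G GP] := choice part.
exists (fun b => G (actr b z) b); split=> [b s|c].
  by rewrite actz; have [Ghom _] := GP (actr b z); exact: Ghom.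
by have [_ Gf] := GP (actr (sval c) z); exact: Gf.
Qed.

(** * Quotients by right congruences *)

Section QuotientAct.
Variables (S : monoidType) (rho : S -> S -> Prop).
Hypothesis rhoP : right_congruence rho.

Let r (u v : S) := `[< rho u v >].

Fact quotient_refl : reflexive r.
Proof. by move=> u; apply/asboolP; exact: right_congruence_refl. Qed.

Fact quotient_sym : symmetric r.
Proof.
by move=> u v; apply/asboolP/asboolP; exact: right_congruence_sym.
Qed.

Fact quotient_trans : transitive r.
Proof.
move=> v u w /asboolP uv /asboolP vw; apply/asboolP.
exact: right_congruence_trans uv vw.
Qed.

Canonical quotient_equiv :=
  EquivRel r quotient_refl quotient_sym quotient_trans.

Definition quotient_sort : Type := {eq_quot quotient_equiv}.

Definition quotient_pi (u : S) : quotient_sort :=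
  \pi_({eq_quot quotient_equiv}) u.

Lemma quotient_piP u v : quotient_pi u = quotient_pi v <-> rho u v.
Proof.
split=> [/eqP|/asboolP ruv]; first by rewrite eqmodE => /asboolP.
by apply/eqP; rewrite eqmodE.
Qed.

Definition quotient_actr (q : quotient_sort) (s : S) : quotient_sort :=
  quotient_pi (repr (q : {eq_quot quotient_equiv}) * s).

Lemma quotient_actr_pi u s :
  quotient_actr (quotient_pi u) s = quotient_pi (u * s).
Proof.
apply/quotient_piP; apply: (right_congruence_mulr rhoP); apply/quotient_piP.
by rewrite /quotient_pi reprK.
Qed.

Lemma quotient_pi_surj q : exists u, q = quotient_pi u.
Proof.
by exists (repr (q : {eq_quot quotient_equiv})); rewrite /quotient_pi reprK.
Qed.

Fact quotient_actrM q s t :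
  quotient_actr (quotient_actr q s) t = quotient_actr q (s * t).
Proof.
by have [u ->] := quotient_pi_surj q; rewrite !quotient_actr_pi mulgA.
Qed.

Fact quotient_actr1 q : quotient_actr q 1 = q.
Proof.
by have [u ->] := quotient_pi_surj q; rewrite quotient_actr_pi mulg1.
Qed.

Definition quotient_act : act S :=
  Act (inhabits (quotient_pi 1)) quotient_actrM quotient_actr1.

End QuotientAct.

(** * Special idempotents *)

(** Any homomorphism from a quotient of [S] is determined by the image of the
    class of [1].  A retraction of [S] onto [I] therefore sends [s] to [e s]
    with [e] in [I], and this [e] fixes [I].  Likewise a retraction of [S / rho]
    onto the image of [I] sends the class of [u] to that of [k u]; being well
    defined it gives the compatibility of [k] with [rho], and fixing the class
    of [e] it gives [k e] congruent to [e]. *)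
Lemma special_idempotent_generator (S : monoidType) (I : right_ideal S) :
  right_absolutely_injective S ->
  exists e : S, special_idempotent e /\ subact_set I = principal_right_ideal e.
Proof.
move=> injS.
have [|g [ghom gI]] := injS (act_of_subact I) (regular_act S) I id.
  by move=> c s.
pose e : S := sval (g 1).
have gE s : sval (g s) = e * s.
  by rewrite -[s in LHS](mul1g s) -[1 * s]/(actr (1 : regular_act S) s) ghom.
have eI s : subact_set I s -> e * s = s.
  by move=> Is; rewrite -gE (gI (exist _ s Is)).
have IeS : subact_set I = principal_right_ideal e.
  apply/seteqP; split=> [s Is|_ [s _ <-]]; first by exists s; rewrite // eI.
  by rewrite -gE; exact: svalP.
exists e; split=> //; split; first by apply: eI; exact: svalP.
move=> rho rhoP; pose Q := quotient_act rhoP.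
pose p : S -> Q := quotient_pi rhoP.
have pP u v : p u = p v <-> rho u v by exact: quotient_piP.
have pact u s : actr (p u) s = p (u * s) by exact: quotient_actr_pi.
have Jcl (q : Q) s : [set p i | i in subact_set I] q ->
    [set p i | i in subact_set I] (actr q s).
  move=> [i Ii <-]; exists (i * s); last by rewrite pact.
  exact: (@subact_closed _ _ I).
have J0 : [set p i | i in subact_set I] !=set0.
  by have [i Ii] := subact_nonempty I; exists (p i), i.
pose J := Subact J0 Jcl.
have [|h [hhom hJ]] := injS (act_of_subact J) Q J id; first by move=> c s.
have [k Ik hk] := svalP (h (p 1)).
have hp u : sval (h (p u)) = p (k * u).
  have -> : p u = actr (p 1) u by rewrite pact mul1g.
  by rewrite hhom /= -hk; exact: pact.
exists k; split; first by rewrite -IeS.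
- apply/pP; rewrite -hp.
  have Je : subact_set J (p e) by exists e => //; exact: svalP.
  by rewrite (hJ (exist _ (p e) Je)).
- by move=> u v /pP puv; apply/pP; rewrite -!hp puv.
Qed.

(** * Extending homomorphisms *)

Section Extension.
Variables (S : monoidType) (A B : act S).

(** Partial homomorphisms from [B] to [A] are handled through their graphs, so
    that the union of a chain is a union of sets. *)
Definition partial_hom (H : set (B * A)) : Prop :=
  (forall b a a', H (b, a) -> H (b, a') -> a = a') /\
  (forall b a s, H (b, a) -> H (actr b s, actr a s)).

Hypothesis S_left_zero : exists z : S, left_zero z *%g.
Hypothesis S_special : forall I : right_ideal S, exists e : S,
  special_idempotent e /\ subact_set I = principal_right_ideal e.

(** The element [a] is a possible value at [b]: the first conclusion makes
    [b s |-> a s] well defined, the second makes it agree with [H].  When [H] is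
    defined at some [b s], the special idempotent [e] generating the ideal of
    such [s] yields [k] in this ideal, and [a] is the value of [H] at [b k]. *)
Lemma partial_hom_extend_point (H : set (B * A)) (b : B) :
  partial_hom H ->
  exists a, (forall s t, actr b s = actr b t -> actr a s = actr a t) /\
            (forall s a', H (actr b s, a') -> a' = actr a s).
Proof.
move=> [Hfun Hact].
pose I0 : set (regular_act S) := [set s : S | exists a, H (actr b s, a)].
have [I0n|I0e] := pselect (I0 !=set0); last first.
  have [z zl] := S_left_zero; have [a0] := act_inhabited A.
  exists (actr a0 z); split=> [s t _|s a' Hs]; first by rewrite !actrM !zl.
  by case: I0e; exists s, a'.
have I0cl (s : regular_act S) t : I0 s -> I0 (actr s t).
  by move=> [a Ha]; exists (actr a t); rewrite -actrM; exact: Hact.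
have [e [[ee espec] Ie]] := S_special (Subact I0n I0cl).
pose rho u v := actr b u = actr b v.
have rhoP : right_congruence rho.
  split=> [//|u v //|u v w|u v s]; rewrite /rho; first by move=> -> ->.
  by rewrite -!actrM => ->.
have [k [ek kee kcompat]] := espec rho rhoP.
have [a Ha] : I0 k by rewrite -[I0]/(subact_set (Subact I0n I0cl)) Ie.
have Hk s : H (actr b (k * s), actr a s) by rewrite -actrM; exact: Hact.
exists a; split=> [s t bst|s a' Ha'].
  by apply: Hfun (Hk s) _; rewrite (kcompat s t bst).
have {}Ha' : H (actr b (k * s), a').
  have [t _ es] : principal_right_ideal e s by rewrite -Ie; exists a'.
  suff -> : actr b (k * s) = actr b s by [].
  have es' : s = e * s by rewrite -es mulgA ee.
  rewrite es' mulgA -[LHS]actrM -[RHS]actrM.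
  by rewrite (kee : actr b (k * e) = actr b e).
exact: Hfun Ha' (Hk s).
Qed.

Lemma extends_to_of_special (C : subact B) (f : act_of_subact C -> A) :
  act_hom f -> extends_to f.
Proof.
move=> fhom.
pose Gf : set (B * A) := [set (sval c, f c) | c in [set: act_of_subact C]].
have Gffun (c : act_of_subact C) a : Gf (sval c, a) -> a = f c.
  by move=> [d _ [cd <-]]; congr f; apply: sval_inj.
have [F FP totF|G [HP Gmax]] :=
  (* Taking the union with [Gf] makes every candidate extend [f], the empty set
     included, so that the empty chain has an upper bound too. *)
  @Zorn_bigcup _ (fun G : set (B * A) => partial_hom (Gf `|` G)).
  have Gfact b a s : Gf (b, a) -> Gf (actr b s, actr a s).
    by move=> [c _ [<- <-]]; exists (actr c s); rewrite // fhom.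
  split=> [b a a'|b a s [Gba|[X FX Xba]]].
  - move=> [Gba|[X FX Xba]] [Gba'|[Y FY Yba']].
    + by move: Gba Gba' => [c _ [<- <-]] /Gffun.
    + by have [Yfun _] := FP Y FY; apply: (Yfun b); [left | right].
    + by have [Xfun _] := FP X FX; apply: (Xfun b); [right | left].
    + have [XY|YX] := totF X Y FX FY.
        by have [Yfun _] := FP Y FY; apply: (Yfun b); right; [exact: XY|].
      by have [Xfun _] := FP X FX; apply: (Xfun b); right; [|exact: YX].
  - by left; exact: Gfact.
  - have [_ /(_ b a s)] := FP X FX; case; first by right.
      by left.
    by move=> XX; right; exists X.
set H := Gf `|` G in HP; have [Hfun Hact] := HP.
have Htot b : exists a, H (b, a).
  have [//|nb] := pselect (exists a, H (b, a)); exfalso.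
  have [a [aa Ha]] := partial_hom_extend_point b HP.
  pose N : set (B * A) := [set (actr b s, actr a s) | s in setT].
  apply: (Gmax (G `|` N)).
    split=> [|GN]; first exact: subsetUl.
    apply: nb; exists a; right; apply: GN; right; exists 1 => //.
    by rewrite !actr1.
  rewrite setUA -/H; split=> [x y y'|x y s].
  - move=> [Hy|[s _ [<- <-]]] [Hy'|[t _ [bst <-]]].
    + exact: Hfun Hy Hy'.
    + by apply: Ha; rewrite bst.
    + by apply/esym/Ha.
    + by apply: aa.
  - case=> [Hy|[t _ [<- <-]]]; first by left; exact: Hact.
    by right; exists (t * s); rewrite // !actrM.
have [g gH] := choice Htot.
exists g; split=> [b s|c]; first exact: Hfun (gH _) (Hact _ _ s (gH b)).
by apply: Hfun (gH _) _; left; exists c.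
Qed.

End Extension.

Theorem theorem3p9 (S : monoidType) :
  [<-> (forall A : act S, InD_injective A);
       (forall A : act S, indecomposable A -> InD_injective A);
       (forall A : act S, PInD_injective A);
       (forall A : act S, indecomposable A -> PInD_injective A);
       (forall A : act S, indecomposable A -> injective_act A);
       right_absolutely_injective S;
       (exists z : S, left_zero z *%g) /\
       (forall I : right_ideal S, exists e : S,
          special_idempotent e /\ subact_set I = principal_right_ideal e)].
Proof.
tfae.
- by move=> injS A _; exact: injS.
- move=> injS A B C f indecC fhom _.
  have indecF := indecomposable_image_subact (fhom := fhom) indecC.
  have fP c : range f (f c) by exists c.
  have [|g [ghom gf]] :=
      injS _ indecF B C (fun c => exist _ (f c) (fP c)) indecC.
    by move=> c s; apply: sval_inj; rewrite /= fhom.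
  exists (fun b => sval (g b)); split=> [b s|c]; first by rewrite ghom.
  by rewrite gf.
- by move=> injS A _; exact: injS.
- move=> injS A indecA; apply: absolute_retract_injective.
  exact: PInD_injective_retract (injS A indecA).
- exact: absolutely_injective_of_indecomposable.
- move=> injS; split=> [|I]; last exact: special_idempotent_generator.
  exact/exists_left_zero/injective_PInD_injective/injS.
- move=> [zS specS] A B C f _; exact: extends_to_of_special.
Qed.
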